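(* Let $d:A\to A$ be a derivation of a ring $A$ and let $(B,\delta)$ be a differential $(A,d)$-algebra such that $B$ is finitely generated and free as an $A$-module, of rank $\ell\geq 1$. Let $W$ denote the classical Weil descent from $B$-algebras to $A$-algebras, and for a $B$-algebra $D$ let $W_D:D\to W(D)\otimes_A B$ be the component at $D$ of the unit of the adjunction. (i) Let $(D,\partial)$ be a differential $(B,\delta)$-algebra. Then there is a unique derivation $\partial^W$ on $W(D)$ such that $(W(D),\partial^W)$ is a differential $(A,d)$-algebra and $W_D$ is a differential $(B,\delta)$-algebra homomorphism $$(D,\partial)\longrightarrow (W(D)\otimes_A B,\ \partial^W\otimes\delta).$$ (ii) Let $D$ be a $B$-algebra such that $B$ is a subring of $D$ and the inclusion $B\hookrightarrow D$ is the structure morphism of $D$ as a $B$-algebra. Let $\mathrm{Der}_B(D)$ be the set of all derivations $\partial$ of $D$ for which there are a derivation $d'$ of $A$ and a derivation $\delta'$ of $B$ such that $(B,\delta')$ is a differential $(A,d')$-algebra and $(D,\partial)$ is a differential $(B,\delta')$-algebra; for $\partial\in\mathrm{Der}_B(D)$ let $\partial^W$ be the derivation of $W(D)$ given by (i) applied with such $d'$ and $\delta'$. Then the assignment $\partial\mapsto\partial^W$, from $\mathrm{Der}_B(D)$ to the derivations of $W(D)$, is a Lie ring homomorphism and an $A$-module homomorphism.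
   Context: All rings and algebras are commutative and unital, and their homomorphisms are unital; the characteristic is arbitrary. A derivation of a ring $R$ is an additive map $R\to R$ satisfying the Leibniz rule; the set of derivations of $R$ is a Lie ring under $[\partial_1,\partial_2]=\partial_1\partial_2-\partial_2\partial_1$, and if $R$ is an $A$-algebra it is also an $A$-module. A differential $(A,d)$-algebra is an $A$-algebra $C$ with a derivation $\eta$ of $C$ such that the structure map $(A,d)\to(C,\eta)$ commutes with the derivations. A differential $(A,d)$-algebra homomorphism is an $A$-algebra homomorphism commuting with the derivations. For differential $(A,d)$-algebras $(C,\eta)$ and $(B,\delta)$, $\eta\otimes\delta$ denotes the unique derivation on $C\otimes_A B$ for which the natural maps $C\to C\otimes_A B$ and $B\to C\otimes_A B$ are differential; explicitly $(\eta\otimes\delta)(c\otimes b)=\eta(c)\otimes b+c\otimes\delta(b)$. Classical Weil descent: if $B$ is an $A$-algebra that is finitely generated and free as an $A$-module, the functor $F$ from $A$-algebras to $B$-algebras, $F(C)=C\otimes_A B$, $F(\phi)=\phi\otimes\mathrm{id}_B$, has a left adjoint $W$. For every $B$-algebra $D$, the $A$-algebra $W(D)$ together with the $B$-algebra homomorphism $W_D:D\to W(D)\otimes_A B$ (the unit at $D$) is determined up to unique isomorphism by the property that for every $A$-algebra $C$ the map $\phi\mapsto(\phi\otimes\mathrm{id}_B)\circ W_D$ is a bijection from $A$-algebra homomorphisms $W(D)\to C$ to $B$-algebra homomorphisms $D\to C\otimes_A B$. *)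

(* Defs.v *)
From HB Require Import structures.
From mathcomp Require Import all_boot all_order all_algebra.
From mathcomp Require Import boolp.

Set Implicit Arguments.
Unset Strict Implicit.
Unset Printing Implicit Defensive.

Import GRing.Theory.
Local Open Scope ring_scope.
Local Open Scope quotient_scope.

(* The zero ring is allowed: W(D) may be zero even when A, B and D are not.
   [comAlgType] excludes it, so an A-algebra is given here as a ring C of type
   [comPzRingType] together with its structure map iC : A -> C. *)

Section Algebras.
Variables (A C C' : comPzRingType).
Variables (iC : {rmorphism A -> C}) (iC' : {rmorphism A -> C'}).

Definition alg_hom (phi : C -> C') : Prop := forall a, phi (iC a) = iC' a.

Definition free_of_rank (l : nat) : Prop :=
  exists e : 'I_l -> C, forall c : C,
    exists! a : {ffun 'I_l -> A}, c = \sum_(i < l) iC (a i) * e i.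

End Algebras.

Section Derivations.

Definition derivation (R : comPzRingType) (d : R -> R) : Prop :=
  {morph d : x y / x + y} /\ forall x y, d (x * y) = d x * y + x * d y.

Definition der_bracket (R : comPzRingType) (d1 d2 : R -> R) : R -> R :=
  (d1 \o d2) \- (d2 \o d1).

Definition der_scale (A R : comPzRingType) (i : A -> R) (a : A) (d : R -> R) :
  R -> R := fun x => i a * d x.

(* A set of maps R -> R closed under the A-module and Lie ring operations. *)
Definition lie_submodule (A R : comPzRingType) (i : A -> R)
    (P : (R -> R) -> Prop) : Prop :=
  [/\ P \0,
      forall d1 d2, P d1 -> P d2 -> P (d1 \+ d2),
      forall d1, P d1 -> P (\- d1),
      forall a d1, P d1 -> P (der_scale i a d1) &
      forall d1 d2, P d1 -> P d2 -> P (der_bracket d1 d2)].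

(* [diff_alg iC d eta]: (C, eta) is a differential (A, d)-algebra, the
   hypothesis that d is a derivation of A being stated separately. *)
Definition diff_alg (A C : comPzRingType) (iC : {rmorphism A -> C})
    (d : A -> A) (eta : C -> C) : Prop :=
  derivation eta /\ forall a, eta (iC a) = iC (d a).

Definition diff_alg_hom (A C C' : comPzRingType) (iC : {rmorphism A -> C})
    (iC' : {rmorphism A -> C'}) (eta : C -> C) (eta' : C' -> C')
    (phi : C -> C') : Prop :=
  alg_hom iC iC' phi /\ forall c, phi (eta c) = eta' (phi c).

End Derivations.

(* The tensor product of C and B over A: formal sums of pairs (c, b), encoded
   as sequences, two of which are identified when every A-balanced biadditive
   map to an abelian group takes the same value on them. *)
Section Tensor.
Variables (A C B : comPzRingType).
Variables (iC : {rmorphism A -> C}) (iB : {rmorphism A -> B}).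

Definition balanced (M : zmodType) (f : C -> B -> M) : Prop :=
  [/\ forall c c' b, f (c + c') b = f c b + f c' b,
      forall c b b', f c (b + b') = f c b + f c b' &
      forall a c b, f (iC a * c) b = f c (iB a * b)].

Definition fsum (M : zmodType) (f : C -> B -> M) (s : seq (C * B)) : M :=
  \sum_(p <- s) f p.1 p.2.

Definition tensor_rel (s t : seq (C * B)) : bool :=
  `[< forall (M : zmodType) (f : C -> B -> M),
        balanced f -> fsum f s = fsum f t >].

Lemma tensor_rel_equiv : equiv_class_of tensor_rel.
Proof.
split=> [s|s t|t s u].
- exact/asboolP.
- by apply/asboolP/asboolP => h M f /h.
- by move=> /asboolP h1 /asboolP h2; apply/asboolP => M f bf; rewrite h1 ?h2.
Qed.

Canonical tensor_equiv := EquivRelPack tensor_rel_equiv.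

Definition tensor : Type := {eq_quot tensor_equiv}.
HB.instance Definition _ := Choice.on tensor.
HB.instance Definition _ := EqQuotient.on tensor.

Definition tens (c : C) (b : B) : tensor := \pi_tensor [:: (c, b)].

(* The map on the tensor product induced by f; meaningful for balanced f. *)
Definition tensor_lift (M : zmodType) (f : C -> B -> M) (x : tensor) : M :=
  fsum f (repr x).

Lemma tensor_lift_pi (M : zmodType) (f : C -> B -> M) s :
  balanced f -> tensor_lift f (\pi_tensor s) = fsum f s.
Proof.
move=> bf; rewrite /tensor_lift.
have /eqmodP/asboolP -> // : \pi_tensor (repr (\pi_tensor s)) = \pi_tensor s.
by rewrite reprK.
Qed.

Lemma tensor_lift_tens (M : zmodType) (f : C -> B -> M) c b :
  balanced f -> tensor_lift f (tens c b) = f c b.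
Proof. by move=> bf; rewrite tensor_lift_pi // /fsum big_seq1. Qed.

Lemma eq_tensor (x y : tensor) :
  (forall (M : zmodType) (f : C -> B -> M),
     balanced f -> tensor_lift f x = tensor_lift f y) -> x = y.
Proof.
move=> h; rewrite -[x]reprK -[y]reprK; apply/eqmodP/asboolP => M f bf.
exact: h.
Qed.

Lemma balanced0l (M : zmodType) (f : C -> B -> M) b : balanced f -> f 0 b = 0.
Proof.
by case=> fl _ _; apply: (addrI (f 0 b)); rewrite -fl !addr0.
Qed.

Lemma balancedNl (M : zmodType) (f : C -> B -> M) c b :
  balanced f -> f (- c) b = - f c b.
Proof.
move=> bf; apply: (addrI (f c b)); rewrite subrr.
by case: (bf) => <- _ _; rewrite subrr balanced0l.
Qed.

Definition tensor0 : tensor := \pi_tensor [::].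
Definition tensor_add (x y : tensor) : tensor := \pi_tensor (repr x ++ repr y).
Definition tensor_opp (x : tensor) : tensor :=
  \pi_tensor [seq (- p.1, p.2) | p <- repr x].

Lemma tensor_lift0 (M : zmodType) (f : C -> B -> M) :
  balanced f -> tensor_lift f tensor0 = 0.
Proof. by move=> bf; rewrite tensor_lift_pi // /fsum big_nil. Qed.

Lemma tensor_lift_add (M : zmodType) (f : C -> B -> M) x y :
  balanced f ->
  tensor_lift f (tensor_add x y) = tensor_lift f x + tensor_lift f y.
Proof. by move=> bf; rewrite tensor_lift_pi // /fsum big_cat. Qed.

Lemma tensor_lift_opp (M : zmodType) (f : C -> B -> M) x :
  balanced f -> tensor_lift f (tensor_opp x) = - tensor_lift f x.
Proof.
move=> bf; rewrite tensor_lift_pi // /tensor_lift /fsum big_map -sumrN.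
by apply: eq_bigr => p _; rewrite balancedNl.
Qed.

Lemma tensor_addA : associative tensor_add.
Proof.
by move=> x y z; apply: eq_tensor => M f bf; rewrite !tensor_lift_add // addrA.
Qed.

Lemma tensor_addC : commutative tensor_add.
Proof.
by move=> x y; apply: eq_tensor => M f bf; rewrite !tensor_lift_add // addrC.
Qed.

Lemma tensor_add0 : left_id tensor0 tensor_add.
Proof.
move=> x; apply: eq_tensor => M f bf.
by rewrite tensor_lift_add // tensor_lift0 // add0r.
Qed.

Lemma tensor_addN : left_inverse tensor0 tensor_opp tensor_add.
Proof.
move=> x; apply: eq_tensor => M f bf.
by rewrite tensor_lift_add // tensor_lift_opp // tensor_lift0 // addNr.
Qed.

HB.instance Definition _ :=
  GRing.isZmodule.Build tensor tensor_addA tensor_addC tensor_add0 tensor_addN.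

Lemma tensor_liftD (M : zmodType) (f : C -> B -> M) :
  balanced f -> {morph tensor_lift f : x y / x + y}.
Proof. by move=> bf x y; apply: tensor_lift_add. Qed.

Lemma tens_balanced : balanced tens.
Proof.
split=> *; apply: eq_tensor => M f bf;
  rewrite ?tensor_liftD // !tensor_lift_tens //; by case: bf.
Qed.

Lemma tensor_ind (P : tensor -> Prop) :
  P 0 -> (forall c b x, P x -> P (tens c b + x)) -> forall x, P x.
Proof.
move=> P0 PS x; rewrite -[x]reprK; elim: (repr x) => [|[c b] s ih] //.
rewrite (_ : \pi_tensor ((c, b) :: s) = tens c b + \pi_tensor s); first exact: PS.
apply: eq_tensor => M f bf; rewrite tensor_liftD // tensor_lift_tens //.
by rewrite !tensor_lift_pi // /fsum big_cons.
Qed.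

(* Universal property of the tensor product. *)
Lemma tensor_lift_uniq (M : zmodType) (f : C -> B -> M) (g : tensor -> M) :
  balanced f -> {morph g : x y / x + y} ->
  (forall c b, g (tens c b) = f c b) -> g =1 tensor_lift f.
Proof.
move=> bf gD gf; elim/tensor_ind => [|c b x ih].
  rewrite tensor_lift0 //; apply: (addrI (g 0)).
  by rewrite -gD !addr0.
by rewrite gD tensor_liftD // gf ih tensor_lift_tens.
Qed.

(* (c1 ⊗ b1) * (c2 ⊗ b2) = (c1 * c2) ⊗ (b1 * b2), extended biadditively. *)
Definition tensor_mul (x y : tensor) : tensor :=
  tensor_lift (fun c1 b1 =>
    tensor_lift (fun c2 b2 => tens (c1 * c2) (b1 * b2)) y) x.

Lemma tensor_mul_bal2 c1 b1 :
  balanced (fun c2 b2 => tens (c1 * c2) (b1 * b2)).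
Proof.
case: tens_balanced => tl tr ta; split=> *.
- by rewrite mulrDr tl.
- by rewrite mulrDr tr.
- by rewrite mulrCA ta mulrCA.
Qed.

Lemma tensor_mul_bal1 y :
  balanced (fun c1 b1 =>
    tensor_lift (fun c2 b2 => tens (c1 * c2) (b1 * b2)) y).
Proof.
case: tens_balanced => tl tr ta; split=> *;
  rewrite /tensor_lift /fsum -?big_split /=; apply: eq_bigr => p _.
- by rewrite mulrDl tl.
- by rewrite mulrDl tr.
- by rewrite -mulrA ta mulrA.
Qed.

Lemma tensor_mul_tens c1 b1 c2 b2 :
  tensor_mul (tens c1 b1) (tens c2 b2) = tens (c1 * c2) (b1 * b2).
Proof.
rewrite /tensor_mul tensor_lift_tens; last exact: tensor_mul_bal1.
by rewrite tensor_lift_tens //; apply: tensor_mul_bal2.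
Qed.

Lemma tensor_mulDl : left_distributive tensor_mul +%R.
Proof. by move=> x y z; apply: tensor_liftD; apply: tensor_mul_bal1. Qed.

Lemma tensor_mul0l x : tensor_mul 0 x = 0.
Proof. by apply: tensor_lift0; apply: tensor_mul_bal1. Qed.

Lemma tensor_mulC : commutative tensor_mul.
Proof.
have tens_mulDr c b y z : tensor_mul (tens c b) (y + z)
    = tensor_mul (tens c b) y + tensor_mul (tens c b) z.
  rewrite /tensor_mul !tensor_lift_tens; try exact: tensor_mul_bal1.
  by apply: tensor_liftD; apply: tensor_mul_bal2.
have tens_mul0r c b : tensor_mul (tens c b) 0 = 0.
  rewrite /tensor_mul !tensor_lift_tens; last exact: tensor_mul_bal1.
  by apply: tensor_lift0; apply: tensor_mul_bal2.
have tensC c b y : tensor_mul (tens c b) y = tensor_mul y (tens c b).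
  elim/tensor_ind: y => [|c' b' y ih]; first by rewrite tensor_mul0l.
  rewrite tensor_mulDl tens_mulDr ih !tensor_mul_tens.
  by rewrite (mulrC c) (mulrC b).
have mul0r y : tensor_mul y 0 = 0.
  elim/tensor_ind: y => [|c b y ih]; first exact: tensor_mul0l.
  by rewrite tensor_mulDl tens_mul0r ih addr0.
have mulDr y c b z : tensor_mul y (tens c b + z)
    = tensor_mul y (tens c b) + tensor_mul y z.
  elim/tensor_ind: y => [|c' b' y ih]; first by rewrite !tensor_mul0l addr0.
  by rewrite !tensor_mulDl tens_mulDr ih addrACA.
move=> x y; elim/tensor_ind: x => [|c b x ih].
  by rewrite tensor_mul0l mul0r.
by rewrite tensor_mulDl mulDr ih tensC.
Qed.

Lemma tensor_mulA : associative tensor_mul.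
Proof.
have mulDr x y z : tensor_mul x (y + z) = tensor_mul x y + tensor_mul x z.
  by rewrite !(tensor_mulC x) tensor_mulDl.
move=> x y z; elim/tensor_ind: x => [|c b x ihx]; first by rewrite !tensor_mul0l.
rewrite !tensor_mulDl ihx; congr (_ + _) => {ihx}.
elim/tensor_ind: y => [|c' b' y ihy].
  by rewrite tensor_mul0l (tensor_mulC _ 0) tensor_mul0l tensor_mul0l.
rewrite tensor_mulDl !mulDr tensor_mulDl ihy; congr (_ + _) => {ihy}.
elim/tensor_ind: z => [|c'' b'' z ihz].
  by rewrite 2!(tensor_mulC _ 0) !tensor_mul0l (tensor_mulC _ 0) tensor_mul0l.
by rewrite !mulDr ihz !tensor_mul_tens !mulrA.
Qed.

Lemma tensor_mul1 : left_id (tens 1 1) tensor_mul.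
Proof.
move=> x; rewrite tensor_mulC; elim/tensor_ind: x => [|c b x ih].
  exact: tensor_mul0l.
by rewrite tensor_mulDl ih tensor_mul_tens !mulr1.
Qed.

HB.instance Definition _ := GRing.Zmodule_isComPzRing.Build tensor
  tensor_mulA tensor_mulC tensor_mul1 tensor_mulDl.

Lemma tensM c1 b1 c2 b2 :
  tens c1 b1 * tens c2 b2 = tens (c1 * c2) (b1 * b2).
Proof. exact: tensor_mul_tens. Qed.

Definition tens_inl (c : C) : tensor := tens c 1.
Definition tens_inr (b : B) : tensor := tens 1 b.

Lemma tens_inl_is_nmod_morphism : nmod_morphism tens_inl.
Proof.
split; last by move=> c c'; case: tens_balanced => tl _ _; apply: tl.
exact: balanced0l tens_balanced.
Qed.

Lemma tens_inl_is_monoid_morphism : monoid_morphism tens_inl.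
Proof. by split=> // c c'; rewrite /tens_inl tensM mulr1. Qed.

HB.instance Definition _ :=
  GRing.isNmodMorphism.Build C tensor tens_inl tens_inl_is_nmod_morphism.
HB.instance Definition _ :=
  GRing.isMonoidMorphism.Build C tensor tens_inl tens_inl_is_monoid_morphism.

Lemma tens_inr_is_nmod_morphism : nmod_morphism tens_inr.
Proof.
case: tens_balanced => _ tr _; split; last by move=> b b'; apply: tr.
by apply: (addrI (tens 1 0)); rewrite -tr !addr0.
Qed.

Lemma tens_inr_is_monoid_morphism : monoid_morphism tens_inr.
Proof. by split=> // b b'; rewrite /tens_inr tensM mulr1. Qed.

(* This makes C ⊗_A B a B-algebra, with structure map b |-> 1 ⊗ b. *)
HB.instance Definition _ :=
  GRing.isNmodMorphism.Build B tensor tens_inr tens_inr_is_nmod_morphism.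
HB.instance Definition _ :=
  GRing.isMonoidMorphism.Build B tensor tens_inr tens_inr_is_monoid_morphism.

Lemma tens_inlr a : tens_inl (iC a) = tens_inr (iB a).
Proof.
by case: tens_balanced => _ _ ta; rewrite /tens_inl -[iC a]mulr1 ta mulr1.
Qed.

(* The derivation eta ⊗ delta: (eta ⊗ delta)(c ⊗ b) = eta c ⊗ b + c ⊗ delta b.
   It is meaningful when (C, eta) and (B, delta) are differential
   (A, d)-algebras for a common d. *)
Definition tensor_der (eta : C -> C) (delta : B -> B) : tensor -> tensor :=
  tensor_lift (fun c b => tens (eta c) b + tens c (delta b)).

Section TensorDer.
Variables (d : A -> A) (eta : C -> C) (delta : B -> B).
Hypotheses (etaP : diff_alg iC d eta) (deltaP : diff_alg iB d delta).

Lemma tensor_der_balanced :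
  balanced (fun c b => tens (eta c) b + tens c (delta b)).
Proof.
case: tens_balanced => tl tr ta.
case: etaP => -[etaD etaM] etai; case: deltaP => -[delD delM] deli.
split=> [c c' b|c b b'|a c b].
- by rewrite etaD !tl addrACA.
- by rewrite delD !tr addrACA.
- by rewrite etaM etai tl !ta delM deli tr -addrA addrCA.
Qed.

Lemma tensor_derE c b :
  tensor_der eta delta (tens c b) = tens (eta c) b + tens c (delta b).
Proof. exact/tensor_lift_tens/tensor_der_balanced. Qed.

Lemma tensor_der_derivation : derivation (tensor_der eta delta).
Proof.
case: tens_balanced => tl tr ta.
case: etaP => -[etaD etaM] etai; case: deltaP => -[delD delM] deli.
have DD : {morph tensor_der eta delta : x y / x + y}.
  exact/tensor_liftD/tensor_der_balanced.
split=> // x y.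
have D0 : tensor_der eta delta 0 = 0 by apply/tensor_lift0/tensor_der_balanced.
elim/tensor_ind: x => [|c b x ihx]; first by rewrite !(mul0r, D0) addr0.
rewrite mulrDl DD DD ihx !mulrDl addrACA; congr (_ + _) => {ihx}.
elim/tensor_ind: y => [|c' b' y ihy]; first by rewrite !(mulr0, D0) addr0.
rewrite !mulrDr DD DD ihy mulrDr addrACA; congr (_ + _).
rewrite tensM !tensor_derE etaM delM tl tr !mulrDl !mulrDr !tensM.
exact: addrACA.
Qed.

Lemma tensor_der_inl c :
  tensor_der eta delta (tens_inl c) = tens_inl (eta c).
Proof.
rewrite tensor_derE; case: deltaP => -[delD delM] _.
have -> : delta 1 = 0.
  by apply: (addrI (delta 1)); rewrite addr0 -{3}[1]mulr1 delM mulr1 mul1r.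
rewrite (_ : tens c 0 = 0) ?addr0 //; case: tens_balanced => _ tr _.
by apply: (addrI (tens c 0)); rewrite -tr !addr0.
Qed.

Lemma tensor_der_inr b :
  tensor_der eta delta (tens_inr b) = tens_inr (delta b).
Proof.
rewrite tensor_derE; case: etaP => -[etaD etaM] _.
have -> : eta 1 = 0.
  by apply: (addrI (eta 1)); rewrite addr0 -{3}[1]mulr1 etaM mulr1 mul1r.
by rewrite (balanced0l _ tens_balanced) add0r.
Qed.

Lemma tensor_der_uniq (D : tensor -> tensor) :
  derivation D -> (forall c, D (tens_inl c) = tens_inl (eta c)) ->
  (forall b, D (tens_inr b) = tens_inr (delta b)) ->
  D =1 tensor_der eta delta.
Proof.
move=> [DD DM] Dl Dr; apply: tensor_lift_uniq => // [|c b].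
  exact: tensor_der_balanced.
have -> : tens c b = tens_inl c * tens_inr b by rewrite tensM mulr1 mul1r.
by rewrite DM Dl Dr !tensM !mulr1 !mul1r.
Qed.

End TensorDer.

End Tensor.

(* The map phi ⊗ id_B; meaningful for A-algebra homomorphisms phi. *)
Definition tensor_map (A C C' B : comPzRingType) (iC : {rmorphism A -> C})
    (iC' : {rmorphism A -> C'}) (iB : {rmorphism A -> B}) (phi : C -> C') :
    tensor iC iB -> tensor iC' iB :=
  tensor_lift (fun c b => tens iC' iB (phi c) b).

Lemma tensor_mapE (A C C' B : comPzRingType) (iC : {rmorphism A -> C})
    (iC' : {rmorphism A -> C'}) (iB : {rmorphism A -> B})
    (phi : {rmorphism C -> C'}) :
  alg_hom iC iC' phi ->
  forall c b, tensor_map iC' phi (tens iC iB c b) = tens iC' iB (phi c) b.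
Proof.
move=> phiA c b; case: (tens_balanced iC' iB) => tl tr ta.
by apply: tensor_lift_tens; split=> *; rewrite ?rmorphD ?rmorphM ?phiA ?tl ?tr.
Qed.

Section WeilDescent.
Variables (A B D W : comPzRingType).
Variables (iB : {rmorphism A -> B}) (jD : {rmorphism B -> D}).
Variables (iW : {rmorphism A -> W}) (u : {rmorphism D -> tensor iW iB}).

(* [weil_descent]: the A-algebra W, with u : D -> W ⊗_A B, is the Weil descent
   W(D) with unit W_D, i.e. u is a B-algebra homomorphism and, for every
   A-algebra C, phi |-> (phi ⊗ id_B) \o u is a bijection from A-algebra
   homomorphisms W -> C to B-algebra homomorphisms D -> C ⊗_A B. *)
Definition weil_descent : Prop :=
  alg_hom jD (tens_inr iW iB) u /\
  forall (C : comPzRingType) (iC : {rmorphism A -> C})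
         (psi : {rmorphism D -> tensor iC iB}),
    alg_hom jD (tens_inr iC iB) psi ->
    exists phi : {rmorphism W -> C},
      [/\ alg_hom iW iC phi,
          tensor_map iC phi \o u =1 psi &
          forall phi' : {rmorphism W -> C},
            alg_hom iW iC phi' -> tensor_map iC phi' \o u =1 psi ->
            phi' =1 phi].

(* [weil_der d delta partial dW]: the defining property of dW = partial^W. *)
Definition weil_der (d : A -> A) (delta : B -> B) (partial : D -> D)
    (dW : W -> W) : Prop :=
  diff_alg iW d dW /\
  diff_alg_hom jD (tens_inr iW iB) partial (tensor_der dW delta) u.

End WeilDescent.

Section DerB.
Variables (A B D : comPzRingType).
Variables (iB : {rmorphism A -> B}) (jD : {rmorphism B -> D}).

(* (B, delta') is a differential (A, d')-algebra and (D, partial) is a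
   differential (B, delta')-algebra. *)
Definition diff_tower (d' : A -> A) (delta' : B -> B) (partial : D -> D) :
    Prop :=
  [/\ derivation d', diff_alg iB d' delta' & diff_alg jD delta' partial].

Definition DerB (partial : D -> D) : Prop :=
  exists d' delta', diff_tower d' delta' partial.

End DerB.

(* Main.v *)
Require Import Defs.
From HB Require Import structures.
From mathcomp Require Import all_boot all_order all_algebra.
From mathcomp Require Import boolp.

Set Implicit Arguments.
Unset Strict Implicit.
Unset Printing Implicit Defensive.

Import GRing.Theory.
Local Open Scope ring_scope.

(** Let W[e] be the dual numbers over W = W(D), made an A-algebra by
    [a |-> a + (d a) e]. The maps
    [s (w ⊗ b) = w ⊗ b - w e ⊗ delta b] and [t (w ⊗ b) = w e ⊗ b] identify
    [(W ⊗_A B)[e]] with [W[e] ⊗_A B], and [x |-> s (u x) + t (u (partial x))]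
    is a B-algebra homomorphism from D to the latter. The Weil descent turns it
    into an A-algebra homomorphism W -> W[e]; this is [w |-> w + (dW w) e] for a
    derivation dW, and it corresponds to the given homomorphism exactly when u
    is differential. Part (ii) follows from this uniqueness, since
    [eta ⊗ delta] is compatible with sums, brackets and scalars, while d' and
    delta' are determined by partial because iB and jD are injective. *)

(** * Derivations, differential algebras and towers A -> B -> D *)

Section Derivations.

Lemma additive0 (U V : zmodType) (f : U -> V) :
  {morph f : x y / x + y} -> f 0 = 0.
Proof. by move=> fD; apply: (addrI (f 0)); rewrite -fD !addr0. Qed.

(** The shape of a commutator of two derivations on a product: the mixed terms [b] and [c] occur
    once with each sign. It serves both the Leibniz rule for brackets and the bracket of two
    derivations [eta ⊗ delta]. *)
Lemma cross_terms_cancel (V : zmodType) (a b c e f g : V) :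
  a + b + (c + e) - (f + c + (b + g)) = a - f + (e - g).
Proof.
rewrite [f + c + _]addrACA opprD addrACA !opprD.
by rewrite [a + b + _]addrACA [c + e + _]addrACA !subrr addr0 add0r.
Qed.

Lemma derivation1 (R : comPzRingType) (d : R -> R) : derivation d -> d 1 = 0.
Proof.
by case=> _ dM; apply: (addrI (d 1)); rewrite addr0 -{3}[1]mulr1 dM mulr1 mul1r.
Qed.

Lemma derivation0 (R : comPzRingType) : derivation (\0 : R -> R).
Proof. by split=> x y /=; rewrite ?mul0r ?mulr0 addr0. Qed.

Lemma derivationD (R : comPzRingType) (d1 d2 : R -> R) :
  derivation d1 -> derivation d2 -> derivation (d1 \+ d2).
Proof.
move=> [D1 M1] [D2 M2]; split=> x y /=; first by rewrite D1 D2 addrACA.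
by rewrite M1 M2 addrACA mulrDl mulrDr.
Qed.

Lemma derivationN (R : comPzRingType) (d : R -> R) :
  derivation d -> derivation (\- d).
Proof.
move=> [dD dM]; split=> x y /=; first by rewrite dD opprD.
by rewrite dM opprD mulNr mulrN.
Qed.

Lemma derivationZ (A R : comPzRingType) (i : A -> R) a (d : R -> R) :
  derivation d -> derivation (der_scale i a d).
Proof.
rewrite /der_scale; move=> [dD dM]; split=> x y; first by rewrite dD mulrDr.
by rewrite dM mulrDr mulrA [in X in _ + X]mulrCA.
Qed.

Lemma derivation_bracket (R : comPzRingType) (d1 d2 : R -> R) :
  derivation d1 -> derivation d2 -> derivation (der_bracket d1 d2).
Proof.
rewrite /der_bracket; move=> [D1 M1] [D2 M2]; split=> x y /=.
  by rewrite D1 D2 D1 D2 opprD addrACA.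
rewrite M1 M2 D1 D2 !M1 !M2 mulrBl mulrBr.
exact: cross_terms_cancel.
Qed.

Section DiffAlg.
Variables (A C : comPzRingType) (iC : {rmorphism A -> C}).

Lemma diff_alg0 : diff_alg iC \0 \0.
Proof. by split=> [|a] /=; [exact: derivation0 | rewrite rmorph0]. Qed.

Lemma diff_algD (d1 d2 : A -> A) (e1 e2 : C -> C) :
  diff_alg iC d1 e1 -> diff_alg iC d2 e2 -> diff_alg iC (d1 \+ d2) (e1 \+ e2).
Proof.
move=> [h1 i1] [h2 i2]; split=> [|a] /=; first exact: derivationD.
by rewrite i1 i2 rmorphD.
Qed.

Lemma diff_algN (d : A -> A) (e : C -> C) :
  diff_alg iC d e -> diff_alg iC (\- d) (\- e).
Proof.
move=> [h1 i1]; split=> [|a] /=; first exact: derivationN.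
by rewrite i1 rmorphN.
Qed.

(** Scalars come from a third ring [K], so that one statement applies to A -> B with [i = id] and to
    B -> D with [i = iB]. *)
Lemma diff_algZ (K : comPzRingType) (i : K -> A) a (d : A -> A) (e : C -> C) :
  diff_alg iC d e ->
  diff_alg iC (der_scale i a d) (der_scale (iC \o i) a e).
Proof.
move=> [h1 i1]; split=> [|b] /=; first exact: derivationZ.
by rewrite /der_scale /= i1 rmorphM.
Qed.

Lemma diff_alg_bracket (d1 d2 : A -> A) (e1 e2 : C -> C) :
  diff_alg iC d1 e1 -> diff_alg iC d2 e2 ->
  diff_alg iC (der_bracket d1 d2) (der_bracket e1 e2).
Proof.
move=> [h1 i1] [h2 i2]; split=> [|a]; first exact: derivation_bracket.
by rewrite /der_bracket /= i1 i2 i1 i2 rmorphB.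
Qed.

End DiffAlg.

Section DerB.
Variables (A B D : comPzRingType).
Variables (iB : {rmorphism A -> B}) (jD : {rmorphism B -> D}).

Lemma diff_towerD d1 d2 e1 e2 p1 p2 :
  diff_tower iB jD d1 e1 p1 -> diff_tower iB jD d2 e2 p2 ->
  diff_tower iB jD (d1 \+ d2) (e1 \+ e2) (p1 \+ p2).
Proof.
by move=> [? ? ?] [? ? ?]; split; [apply: derivationD|apply: diff_algD..].
Qed.

Lemma diff_tower_bracket d1 d2 e1 e2 p1 p2 :
  diff_tower iB jD d1 e1 p1 -> diff_tower iB jD d2 e2 p2 ->
  diff_tower iB jD (der_bracket d1 d2) (der_bracket e1 e2) (der_bracket p1 p2).
Proof.
by move=> [? ? ?] [? ? ?];
   split; [apply: derivation_bracket|apply: diff_alg_bracket..].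
Qed.

Lemma diff_towerZ a d e p :
  diff_tower iB jD d e p ->
  diff_tower iB jD (der_scale id a d) (der_scale iB a e)
    (der_scale (jD \o iB) a p).
Proof.
move=> [? h ?]; split; [exact: derivationZ| |exact: diff_algZ].
exact: (@diff_algZ _ _ iB A id a _ _ h).
Qed.

Lemma DerB_lie_submodule : lie_submodule (jD \o iB) (DerB iB jD).
Proof.
split.
- by exists \0, \0; split; [exact: derivation0|exact: diff_alg0..].
- move=> p1 p2 [d1 [e1 h1]] [d2 [e2 h2]].
  by exists (d1 \+ d2), (e1 \+ e2); apply: diff_towerD.
- move=> p [d [e [? ? ?]]]; exists (\- d), (\- e).
  by split; [exact: derivationN|exact: diff_algN..].
- move=> a p [d [e h]]; exists (der_scale id a d), (der_scale iB a e).
  exact: diff_towerZ.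
- move=> p1 p2 [d1 [e1 h1]] [d2 [e2 h2]].
  by exists (der_bracket d1 d2), (der_bracket e1 e2); apply: diff_tower_bracket.
Qed.

Lemma diff_tower_uniq d1 d2 e1 e2 p :
  injective iB -> injective jD ->
  diff_tower iB jD d1 e1 p -> diff_tower iB jD d2 e2 p -> d1 = d2 /\ e1 = e2.
Proof.
move=> iBI jDI [_ [_ h1] [_ k1]] [_ [_ h2] [_ k2]].
have e12 : e1 = e2 by apply: funext => b; apply: jDI; rewrite -k1 k2.
by split=> //; apply: funext => a; apply: iBI; rewrite -h1 -h2 e12.
Qed.

End DerB.

(** If [iB a = 0], then the zero family and the family with [a] at one index and 0 elsewhere are
    both coordinates of 0, so they coincide. The bound [1 <= l] provides the index. *)
Lemma free_of_rank_inj (A B : comPzRingType) (iB : {rmorphism A -> B}) l :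
  (1 <= l)%N -> free_of_rank iB l -> injective iB.
Proof.
move=> l1 [e he]; apply: raddf_inj => a ia0.
have [a0 [_ a0U]] := he 0.
pose i0 := Ordinal l1.
have h0 : a0 = [ffun=> 0].
  by apply: a0U; rewrite big1 // => i _; rewrite ffunE rmorph0 mul0r.
have ha : a0 = [ffun i => if i == i0 then a else 0].
  apply: a0U; rewrite big1 // => i _; rewrite ffunE.
  by case: ifP; rewrite ?ia0 ?rmorph0 mul0r.
by have /ffunP/(_ i0) := etrans (esym h0) ha; rewrite !ffunE eqxx.
Qed.

End Derivations.

(** Bundles a map given by a formula into a ring homomorphism, the form in which the universal
    property of the Weil descent takes it. *)
Lemma rmorphism_ex (R S : comPzRingType) (f : R -> S) :
  nmod_morphism f -> monoid_morphism f ->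
  exists g : {rmorphism R -> S}, g =1 f.
Proof.
move=> fD fM.
pose mD := GRing.isNmodMorphism.Build R S f fD.
pose mM := GRing.isMonoidMorphism.Build R S f fM.
pose g : {rmorphism R -> S} := HB.pack f mD mM.
by exists g.
Qed.

(** * Dual numbers, and derivations as homomorphisms into them *)

Section Dual.

(* The pair [(x, y)] stands for [x + y e] with [e ^ 2 = 0]. *)
Definition dual (R : comPzRingType) : Type := (R * R)%type.

Variable R : comPzRingType.

HB.instance Definition _ := GRing.Zmodule.copy (dual R) (R * R)%type.

Definition dual_one : dual R := (1, 0).
Definition dual_mul (x y : dual R) : dual R :=
  (x.1 * y.1, x.1 * y.2 + x.2 * y.1).

Lemma dual_mulA : associative dual_mul.
Proof.
move=> [x x'] [y y'] [z z']; rewrite /dual_mul /=.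
by rewrite !mulrDr !mulrDl !mulrA addrA.
Qed.

Lemma dual_mulC : commutative dual_mul.
Proof.
move=> [x x'] [y y']; rewrite /dual_mul /=.
by rewrite addrC (mulrC y) (mulrC y') (mulrC y).
Qed.

Lemma dual_mul1 : left_id dual_one dual_mul.
Proof. by move=> [x x']; rewrite /dual_mul /= !mul1r mul0r addr0. Qed.

Lemma dual_mulDl : left_distributive dual_mul +%R.
Proof.
move=> [x x'] [y y'] [z z']; congr pair; rewrite /= !mulrDl //.
by rewrite addrACA.
Qed.

HB.instance Definition _ := GRing.Zmodule_isComPzRing.Build (dual R)
  dual_mulA dual_mulC dual_mul1 dual_mulDl.

Lemma dualD (x x' y y' : R) :
  ((x, x') : dual R) + (y, y') = (x + y, x' + y').
Proof. by []. Qed.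

Lemma dualM (x x' y y' : R) :
  ((x, x') : dual R) * (y, y') = (x * y, x * y' + x' * y).
Proof. by []. Qed.

Definition dual_fst (x : dual R) : R := x.1.

Lemma dual_fst_is_nmod_morphism : nmod_morphism dual_fst.
Proof. by []. Qed.
Lemma dual_fst_is_monoid_morphism : monoid_morphism dual_fst.
Proof. by []. Qed.
HB.instance Definition _ :=
  GRing.isNmodMorphism.Build (dual R) R dual_fst dual_fst_is_nmod_morphism.
HB.instance Definition _ :=
  GRing.isMonoidMorphism.Build (dual R) R dual_fst dual_fst_is_monoid_morphism.

(** A derivation from [S] to [R], viewed as an [S]-module through [f]: exactly the condition for
    [x |-> f x + (g x) e] to be a ring homomorphism. *)
Definition derivation_along (S : comPzRingType) (f g : S -> R) : Prop :=
  {morph g : x y / x + y} /\ forall x y, g (x * y) = g x * f y + f x * g y.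

(* The proof argument makes the morphism structure inferable. *)
Definition dual_lift (S : comPzRingType) (f : {rmorphism S -> R}) (g : S -> R)
  (_ : derivation_along f g) (x : S) : dual R := (f x, g x).

Section DualLift.
Variables (S : comPzRingType) (f : {rmorphism S -> R}) (g : S -> R).
Hypothesis fg : derivation_along f g.

Lemma dual_lift_is_nmod_morphism : nmod_morphism (dual_lift fg).
Proof.
rewrite /dual_lift; case: fg => gD _; split=> [|x y].
  by rewrite rmorph0 additive0.
by rewrite rmorphD gD.
Qed.

Lemma dual_lift_is_monoid_morphism : monoid_morphism (dual_lift fg).
Proof.
rewrite /dual_lift; case: fg => gD gM; split=> [|x y].
  rewrite rmorph1; congr pair; apply: (addrI (g 1)).
  by rewrite addr0 -{3}[1]mulr1 gM rmorph1 mulr1 mul1r.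
by rewrite rmorphM gM dualM addrC.
Qed.

HB.instance Definition _ :=
  GRing.isNmodMorphism.Build S (dual R) (dual_lift fg)
    dual_lift_is_nmod_morphism.
HB.instance Definition _ :=
  GRing.isMonoidMorphism.Build S (dual R) (dual_lift fg)
    dual_lift_is_monoid_morphism.

End DualLift.
End Dual.

Lemma derivation_along_comp (A W : comPzRingType) (i : {rmorphism A -> W}) d :
  derivation d -> derivation_along i (i \o d).
Proof.
by move=> [dD dM]; split=> x y /=; rewrite ?dD ?dM !rmorphD ?rmorphM.
Qed.

(** * Calculus of pure tensors and extensionality on the tensor product *)

Section TensorExt.
Variables (A C B : comPzRingType).
Variables (iC : {rmorphism A -> C}) (iB : {rmorphism A -> B}).
Local Notation T := (tensor iC iB).
Local Notation "c ⊗ b" := (tens iC iB c b) (at level 35).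

Lemma tensDl c c' b : (c + c') ⊗ b = c ⊗ b + c' ⊗ b.
Proof. by case: (tens_balanced iC iB). Qed.

Lemma tensDr c b b' : c ⊗ (b + b') = c ⊗ b + c ⊗ b'.
Proof. by case: (tens_balanced iC iB). Qed.

Lemma tensA a c b : (iC a * c) ⊗ b = c ⊗ (iB a * b).
Proof. by case: (tens_balanced iC iB). Qed.

Lemma tens0l b : 0 ⊗ b = 0.
Proof. exact: balanced0l (tens_balanced iC iB). Qed.

Lemma tens0r c : c ⊗ 0 = 0.
Proof. by apply: additive0 => b b'; exact: tensDr. Qed.

Lemma tensNl c b : (- c) ⊗ b = - (c ⊗ b).
Proof. exact: balancedNl (tens_balanced iC iB). Qed.

Lemma tensNr c b : c ⊗ (- b) = - (c ⊗ b).
Proof. by apply: (addrI (c ⊗ b)); rewrite -tensDr !subrr tens0r. Qed.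

Lemma tensor_ext (M : zmodType) (f g : T -> M) :
  {morph f : x y / x + y} -> {morph g : x y / x + y} ->
  (forall c b, f (c ⊗ b) = g (c ⊗ b)) -> f =1 g.
Proof.
move=> fD gD fg; elim/tensor_ind => [|c b x ih]; first by rewrite !additive0.
by rewrite fD gD fg ih.
Qed.

Lemma tensor_ext2 (M : zmodType) (f g : T -> T -> M) :
  (forall y, {morph f ^~ y : x x' / x + x'}) ->
  (forall x, {morph f x : y y' / y + y'}) ->
  (forall y, {morph g ^~ y : x x' / x + x'}) ->
  (forall x, {morph g x : y y' / y + y'}) ->
  (forall c b c' b', f (c ⊗ b) (c' ⊗ b') = g (c ⊗ b) (c' ⊗ b')) ->
  forall x y, f x y = g x y.
Proof.
move=> fDl fDr gDl gDr fg x y; move: x.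
apply: (@tensor_ext _ (f ^~ y) (g ^~ y)) => // c b; move: y.
exact: tensor_ext.
Qed.

End TensorExt.

(** * Functoriality of C ↦ C ⊗_A B *)

Section TensorMap.
Variables (A B : comPzRingType) (iB : {rmorphism A -> B}).

Lemma tensor_map_add (C C' : comPzRingType) (iC : {rmorphism A -> C})
    (iC' : {rmorphism A -> C'}) (phi : {rmorphism C -> C'}) :
  alg_hom iC iC' phi ->
  {morph @tensor_map _ _ _ _ iC iC' iB phi : x y / x + y}.
Proof.
move=> phiA; apply: tensor_liftD; split=> *; rewrite ?rmorphD ?rmorphM ?phiA.
- exact: tensDl.
- exact: tensDr.
- exact: tensA.
Qed.

Lemma tensor_map_comp (C C' C'' : comPzRingType) (iC : {rmorphism A -> C})
    (iC' : {rmorphism A -> C'}) (iC'' : {rmorphism A -> C''})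
    (phi : {rmorphism C -> C'}) (phi' : {rmorphism C' -> C''}) :
  alg_hom iC iC' phi -> alg_hom iC' iC'' phi' ->
  @tensor_map _ _ _ _ iC iC'' iB (phi' \o phi) =1
  @tensor_map _ _ _ _ iC' iC'' iB phi' \o @tensor_map _ _ _ _ iC iC' iB phi.
Proof.
move=> h h'.
have hc : alg_hom iC iC'' (phi' \o phi) by move=> a /=; rewrite h h'.
apply: tensor_ext => [|x y|c b] /=; first exact: (tensor_map_add hc).
  by rewrite !tensor_map_add.
by rewrite !tensor_mapE.
Qed.

Lemma tensor_map_id (C : comPzRingType) (iC : {rmorphism A -> C}) :
  @tensor_map _ _ _ _ iC iC iB id =1 id.
Proof.
have h : alg_hom iC iC (@idfun C) by [].
apply: tensor_ext => [|//|c b]; first exact: (tensor_map_add h).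
exact: (tensor_mapE iB (phi := idfun)).
Qed.

End TensorMap.

(** * Part (i): existence and uniqueness of the derivation on the Weil descent *)

Section WeilDer.
Variables (A B D W : comPzRingType).
Variables (iB : {rmorphism A -> B}) (jD : {rmorphism B -> D}).
Variables (iW : {rmorphism A -> W}) (u : {rmorphism D -> tensor iW iB}).
Variables (d : A -> A) (delta : B -> B).
Hypotheses (hd : derivation d) (hdelta : diff_alg iB d delta).

Let twist : {rmorphism A -> dual W} := dual_lift (derivation_along_comp iW hd).
Local Notation T := (tensor iW iB).
Local Notation TD := (tensor twist iB).
Local Notation "c ⊗ b" := (tens iW iB c b) (at level 35).
Local Notation "c ⊗' b" := (tens twist iB c b) (at level 35).

Let tensA' a x y b : ((iW a * x, iW a * y + iW (d a) * x) : dual W) ⊗' b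
  = ((x, y) : dual W) ⊗' (iB a * b).
Proof. by rewrite -tensA. Qed.

(** The subtracted term makes [s] well defined: in the twisted structure, moving [a] across the
    tensor creates a term in [(d a) e], which is cancelled by the one that the Leibniz rule produces
    in [delta (iB a * b)]. *)
Let s : T -> TD := tensor_lift (fun w b =>
  ((w, 0) : dual W) ⊗' b - ((0, w) : dual W) ⊗' (delta b)).
Let t : T -> TD := tensor_lift (fun w b => ((0, w) : dual W) ⊗' b).
(** Extracts the coefficient of [e]: it vanishes on the image of [s] and is a left inverse of [t],
    whence [t] is injective. *)
Let r : TD -> T := tensor_lift (fun (w : dual W) b => w.2 ⊗ b + w.1 ⊗ (delta b)).

Let t_bal : balanced iW iB (fun w b => ((0, w) : dual W) ⊗' b).
Proof.
split=> [c c' b|c b b'|a c b]; last by rewrite -tensA' !mulr0 addr0.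
  by rewrite -tensDl dualD addr0.
exact: tensDr.
Qed.

Let s_bal : balanced iW iB (fun w b =>
  ((w, 0) : dual W) ⊗' b - ((0, w) : dual W) ⊗' (delta b)).
Proof.
have [/= tl tr ta] := t_bal; have [[eD eM] ei] := hdelta.
split=> [c c' b|c b b'|a c b].
- by rewrite tl opprD addrACA -tensDl dualD addr0.
- by rewrite eD !tensDr opprD addrACA.
- rewrite eM ei tensDr -tensA' mulr0 add0r ta -(ta (d a)) opprD addrA.
  congr (_ - _); rewrite -tensNl -tensDl; congr (_ ⊗' _).
  by congr pair; rewrite /= ?subr0 // addrN.
Qed.

Let r_bal : balanced twist iB (fun (w : dual W) b => w.2 ⊗ b + w.1 ⊗ (delta b)).
Proof.
case: hdelta => -[eD eM] ei.
split=> [[c c'] [w w'] b|[c c'] b b'|a [c c'] b] /=.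
- by rewrite !tensDl addrACA.
- by rewrite eD !tensDr addrACA.
- by rewrite eM ei tensDr -!tensA tensDl addrA.
Qed.

Let sE w b : s (w ⊗ b) =
  ((w, 0) : dual W) ⊗' b - ((0, w) : dual W) ⊗' (delta b).
Proof. exact: tensor_lift_tens s_bal. Qed.
Let tE w b : t (w ⊗ b) = ((0, w) : dual W) ⊗' b.
Proof. exact: tensor_lift_tens t_bal. Qed.
Let rE w b : r (w ⊗' b) = w.2 ⊗ b + w.1 ⊗ (delta b).
Proof. exact: tensor_lift_tens r_bal. Qed.
Let sD : {morph s : x y / x + y}. Proof. exact: tensor_liftD s_bal. Qed.
Let tD : {morph t : x y / x + y}. Proof. exact: tensor_liftD t_bal. Qed.
Let rD : {morph r : x y / x + y}. Proof. exact: tensor_liftD r_bal. Qed.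

Let tK : cancel t r.
Proof.
apply: (@tensor_ext _ _ _ _ _ _ (r \o t) id) => // [x y|w b] /=.
  by rewrite tD rD.
by rewrite tE rE tens0l addr0.
Qed.

(** As [e ^ 2 = 0], the correction term of [s x] dies against [t y], a multiple of [e]. *)
Let stM x y : s x * t y = t (x * y).
Proof.
move: x y; apply: tensor_ext2 => [y x x'|x y y'|y x x'|x y y'|w b w' b'];
  rewrite ?sD ?tD ?(mulrDl, mulrDr) ?tD //.
rewrite sE !tE mulrBl !tensM !dualM !(mul0r, mulr0, addr0).
by rewrite tens0l subr0.
Qed.

Let ttM x y : t x * t y = 0.
Proof.
move: x y; apply: (@tensor_ext2 _ _ _ _ _ _ _ (fun _ _ => 0))
  => [y x x'|x y y'|y x x'|x y y'|w b w' b'];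
  rewrite ?tD ?(mulrDl, mulrDr) ?addr0 //.
by rewrite !tE tensM dualM !(mul0r, mulr0) addr0 tens0l.
Qed.

(** The two correction terms multiply to 0, and the cross terms combine into the correction term for
    [b * b'] by the Leibniz rule. *)
Let sM : {morph s : x y / x * y}.
Proof.
case: hdelta => -[eD eM] ei.
apply: tensor_ext2 => [y x x'|x y y'|y x x'|x y y'|w b w' b'];
  rewrite ?sD ?(mulrDl, mulrDr) ?sD //.
rewrite tensM !sE mulrBl !mulrBr !tensM !dualM !(mul0r, mulr0, addr0, add0r).
by rewrite tens0l subr0 eM tensDr opprD addrA addrAC.
Qed.

Let s1 : s 1 = 1.
Proof.
by rewrite sE; case: hdelta => /derivation1 -> _; rewrite tens0r subr0.
Qed.

Lemma weil_descent_lift (partial : D -> D) :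
  alg_hom jD (tens_inr iW iB) u -> diff_alg jD delta partial ->
  exists psi : {rmorphism D -> TD},
    psi =1 (fun x => s (u x) + t (u (partial x))) /\
    alg_hom jD (tens_inr twist iB) psi.
Proof.
move=> uB [hp pj]; case: (hp) => pD pM.
have [||psi psiE] :=
  @rmorphism_ex D TD (fun x => s (u x) + t (u (partial x))).
- split=> [|x y]; last by rewrite pD !rmorphD sD tD addrACA.
  by rewrite !(additive0 pD, rmorph0, additive0 sD, additive0 tD) addr0.
- split=> [|x y].
    by rewrite (derivation1 hp) rmorph1 rmorph0 s1 additive0 // addr0.
  (* Since [s] is multiplicative, [t] absorbs factors from [s], and products of values of [t]
     vanish, this is the Leibniz rule for [partial]. *)
  rewrite pM rmorphM rmorphD !rmorphM sM tD mulrDl !mulrDr ttM addr0 stM.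
  by rewrite [t _ * s _]mulrC stM -addrA [u y * _]mulrC [t _ + t _]addrC.
(* [s] sends [1 ⊗ b] to [1 ⊗ b - e ⊗ delta b]; the excess is cancelled by [t (u (partial (jD b)))],
   because [partial] extends [delta]. *)
exists psi; split=> // b; rewrite psiE pj !uB sE tE.
by rewrite -addrA addNr addr0.
Qed.

(** On [w ⊗ b], the summand [w ⊗ delta b] of the tensor derivation cancels the correction in [s],
    leaving [(w + (dW w) e) ⊗ b]. Precomposed with [u] and compared with
    [s (u x) + t (u (partial x))], this translates between the universal property and the
    differential condition on [u]. *)
Lemma tensor_map_dual (dW : W -> W) (hdW : diff_alg iW d dW)
    (phi : {rmorphism W -> dual W}) :
  (forall w, phi w = (w, dW w)) -> alg_hom iW twist phi ->
  tensor_map twist phi =1 fun x => s x + t (tensor_der dW delta x).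
Proof.
move=> phiE phiA; have [tdD _] := tensor_der_derivation hdW hdelta.
apply: tensor_ext => [|x y|w b]; first exact: tensor_map_add.
- by rewrite tdD sD !tD addrACA.
- rewrite tensor_mapE // (tensor_derE hdW) // tD !tE sE phiE.
  by rewrite [X in _ + X]addrC addrA addrNK -tensDl dualD add0r addr0.
Qed.

Lemma dual_fst_alg_hom : alg_hom twist iW (@dual_fst W).
Proof. by []. Qed.

(** Setting [e = 0] removes the correction term, so it undoes [s]. *)
Let fst_s x : tensor_map iW (@dual_fst W) (s x) = x.
Proof.
have fD := tensor_map_add dual_fst_alg_hom.
apply: (@tensor_ext _ _ _ _ _ _ (tensor_map iW (@dual_fst W) \o s) id)
  => // [y z|w b] /=; first by rewrite sD fD.
rewrite sE -tensNl fD !(tensor_mapE _ dual_fst_alg_hom) /=.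
by rewrite oppr0 tens0l addr0.
Qed.

Let fst_t x : tensor_map iW (@dual_fst W) (t x) = 0.
Proof.
have fD := tensor_map_add dual_fst_alg_hom.
apply: (@tensor_ext _ _ _ _ _ _ (tensor_map iW (@dual_fst W) \o t)
  (fun=> 0)) => // [y z|y z|w b] /=; rewrite ?tD ?fD ?addr0 //.
by rewrite tE (tensor_mapE _ dual_fst_alg_hom) tens0l.
Qed.

Lemma weil_der_exists_unique (partial : D -> D) :
  weil_descent jD u -> diff_alg jD delta partial ->
  exists! dW : W -> W, weil_der jD u d delta partial dW.
Proof.
move=> [uB univ] hpartial.
have [psi [psiE psiB]] := weil_descent_lift uB hpartial.
have [phi [phiA phiu phiU]] := univ _ _ _ psiB.
(* The descent property is applied with [C = W]: after setting [e = 0], [phi] corresponds to [u],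
   and so does the identity of [W], hence the two agree. *)
have fst_phi : @dual_fst W \o phi =1 id.
  have [chi [_ _ chiU]] := univ _ _ _ uB => w.
  have fpA : alg_hom iW iW (@dual_fst W \o phi) by move=> a /=; rewrite phiA.
  rewrite (chiU (@dual_fst W \o phi) fpA) => [|x] /=.
    rewrite -(chiU idfun) // => x /=; exact: tensor_map_id.
  rewrite (tensor_map_comp phiA dual_fst_alg_hom) /=.
  have /= -> := phiu x.
  by rewrite psiE (tensor_map_add dual_fst_alg_hom) fst_s fst_t addr0.
pose dW w := (phi w).2.
have phiE w : phi w = (w, dW w).
  by rewrite [LHS]surjective_pairing; congr pair; exact: fst_phi.
(* In the coefficient of [e], multiplicativity of [phi] is the Leibniz rule, and compatibility with
   [twist] says that [dW] extends [d]. *)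
have hdW : diff_alg iW d dW.
  split=> [|a]; last by rewrite /dW phiA.
  split=> x y; rewrite /dW ?rmorphD // rmorphM !phiE.
  by rewrite dualM /= addrC.
exists dW; split=> [|dW' [hdW' [_ hu']]].
  (* After applying [t] and adding [s (u c)], both sides equal [psi c]. *)
  split=> //; split=> // c; apply: (can_inj tK).
  apply: (addrI (s (u c))); rewrite -(tensor_map_dual hdW phiE phiA).
  by rewrite -psiE -phiu.
(* Any solution [dW'] yields the homomorphism [w + (dW' w) e], which also corresponds to [psi];
   uniqueness of [phi] then forces [dW' = dW]. *)
have dW'P : derivation_along (@idfun W) dW' by case: hdW'.
pose phi' : {rmorphism W -> dual W} := dual_lift dW'P.
have phi'A : alg_hom iW twist phi'.
  by move=> a; congr pair; case: hdW' => _ ->.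
have phi'u : tensor_map twist phi' \o u =1 psi.
  by move=> x; rewrite psiE hu' /= (tensor_map_dual hdW').
by apply: funext => w; rewrite /dW -(phiU phi').
Qed.

End WeilDer.

(** * Part (ii): the defining property under sums, scalars and brackets *)

Section Uniqueness.
Variables (A B D W : comPzRingType).
Variables (iB : {rmorphism A -> B}) (jD : {rmorphism B -> D}).
Variables (iW : {rmorphism A -> W}) (u : {rmorphism D -> tensor iW iB}).

Lemma weil_derD d1 d2 e1 e2 p1 p2 w1 w2 :
  diff_alg iB d1 e1 -> diff_alg iB d2 e2 ->
  weil_der jD u d1 e1 p1 w1 -> weil_der jD u d2 e2 p2 w2 ->
  weil_der jD u (d1 \+ d2) (e1 \+ e2) (p1 \+ p2) (w1 \+ w2).
Proof.
move=> he1 he2 [hw1 [uB hu1]] [hw2 [_ hu2]].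
have he := diff_algD he1 he2; have hw := diff_algD hw1 hw2.
split=> //; split=> // c; rewrite /= rmorphD hu1 hu2; move: (u c).
have [D1 _] := tensor_der_derivation hw1 he1.
have [D2 _] := tensor_der_derivation hw2 he2.
have [D12 _] := tensor_der_derivation hw he.
apply: (@tensor_ext _ _ _ _ _ _
  (tensor_der w1 e1 \+ tensor_der w2 e2)) => // [x y|w b] /=.
  by rewrite D1 D2 addrACA.
rewrite (tensor_derE hw1) // (tensor_derE hw2) // (tensor_derE hw he) /=.
by rewrite tensDl tensDr addrACA.
Qed.

Lemma weil_derZ a d e p w :
  diff_alg iB d e -> weil_der jD u d e p w ->
  weil_der jD u (der_scale id a d) (der_scale iB a e)
    (der_scale (jD \o iB) a p) (der_scale iW a w).
Proof.
move=> he [hw [uB hu]].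
have hae := @diff_algZ _ _ iB A id a _ _ he.
have haw := @diff_algZ _ _ iW A id a _ _ hw.
split=> //; split=> // c; rewrite /der_scale /= rmorphM uB hu.
rewrite -/(der_scale _ _ _).
move: (u c).
have [D1 _] := tensor_der_derivation hw he.
have [D2 _] := tensor_der_derivation haw hae.
apply: (@tensor_ext _ _ _ _ _ _
  (fun x => tens_inr iW iB (iB a) * tensor_der w e x)) => // [x y|x b] /=.
  by rewrite D1 mulrDr.
rewrite (tensor_derE hw) // (tensor_derE haw hae) mulrDr !tensM !mul1r.
(* The scalar enters through [jD \o iB], hence as [1 ⊗ iB a]; balancedness carries it over to the
   factor [W], where it acts through [iW]. *)
by rewrite -tensA.
Qed.

Lemma weil_der_bracket d1 d2 e1 e2 p1 p2 w1 w2 :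
  diff_alg iB d1 e1 -> diff_alg iB d2 e2 ->
  weil_der jD u d1 e1 p1 w1 -> weil_der jD u d2 e2 p2 w2 ->
  weil_der jD u (der_bracket d1 d2) (der_bracket e1 e2) (der_bracket p1 p2)
    (der_bracket w1 w2).
Proof.
move=> he1 he2 [hw1 [uB hu1]] [hw2 [_ hu2]].
have he := diff_alg_bracket he1 he2; have hw := diff_alg_bracket hw1 hw2.
split=> //; split=> // c; rewrite /der_bracket /= rmorphB !hu1 !hu2 hu1.
rewrite -/(der_bracket _ _) -/(der_bracket _ _).
move: (u c).
have [D1 _] := tensor_der_derivation hw1 he1.
have [D2 _] := tensor_der_derivation hw2 he2.
have [D12 _] := tensor_der_derivation hw he.
apply: (@tensor_ext _ _ _ _ _ _
  (der_bracket (tensor_der w1 e1) (tensor_der w2 e2))) => // [x y|x b].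
  by rewrite /der_bracket /= D2 D1 D1 D2 opprD addrACA.
rewrite (tensor_derE hw he) /der_bracket /=.
rewrite (tensor_derE hw1 he1) (tensor_derE hw2 he2) D1 D2.
rewrite !(tensor_derE hw1 he1) !(tensor_derE hw2 he2).
(* The mixed terms [w2 x ⊗ e1 b] and [w1 x ⊗ e2 b] occur in both composites and cancel. *)
by rewrite cross_terms_cancel !tensDl !tensDr tensNl tensNr.
Qed.

End Uniqueness.

(** * The assignment on Der_B(D), obtained from (i) by choice *)

Theorem mainTheorem1
    (A B : comPzRingType) (iB : {rmorphism A -> B})
    (d : A -> A) (delta : B -> B) (l : nat)
    (hd : derivation d) (hdelta : diff_alg iB d delta)
    (hl : (1 <= l)%N) (hfree : free_of_rank iB l) :
  (* (i) *)
  (forall (D : comPzRingType) (jD : {rmorphism B -> D})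
          (W : comPzRingType) (iW : {rmorphism A -> W})
          (u : {rmorphism D -> tensor iW iB}),
     weil_descent jD u ->
     forall partial : D -> D,
       diff_alg jD delta partial ->
       exists! dW : W -> W, weil_der jD u d delta partial dW)
  /\
  (* (ii) *)
  (forall (D : comPzRingType) (jD : {rmorphism B -> D})
          (W : comPzRingType) (iW : {rmorphism A -> W})
          (u : {rmorphism D -> tensor iW iB}),
     weil_descent jD u ->
     injective jD ->
     lie_submodule (jD \o iB) (DerB iB jD) /\
     exists Phi : (D -> D) -> (W -> W),
       [/\ forall d' delta' partial, diff_tower iB jD d' delta' partial ->
             forall dW : W -> W,
               weil_der jD u d' delta' partial dW <-> dW = Phi partial,
           forall d1 d2, DerB iB jD d1 -> DerB iB jD d2 ->
             Phi (d1 \+ d2) = Phi d1 \+ Phi d2,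
           forall d1 d2, DerB iB jD d1 -> DerB iB jD d2 ->
             Phi (der_bracket d1 d2) = der_bracket (Phi d1) (Phi d2) &
           forall (a : A) d1, DerB iB jD d1 ->
             Phi (der_scale (jD \o iB) a d1) = der_scale iW a (Phi d1)]).
Proof.
split=> [D jD W iW u hu partial|D jD W iW u hu jDI].
  exact: weil_der_exists_unique.
split; first exact: DerB_lie_submodule.
have iBI := free_of_rank_inj hl hfree.
(* The membership hypothesis is placed under the existential so that choice gives a total function;
   outside Der_B(D) its value is the placeholder [id]. *)
have Phi_ex partial : exists w : W -> W, DerB iB jD partial ->
    exists d' delta', diff_tower iB jD d' delta' partial /\
      weil_der jD u d' delta' partial w.
  have [[d' [e' [h1 h2 h3]]]|nD] := pselect (DerB iB jD partial).
    have [w [hw _]] := weil_der_exists_unique h1 h2 hu h3.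
    by exists w => _; exists d', e'.
  by exists id.
have [Phi PhiP] := choice Phi_ex.
(* The choice of [d'] and [delta'] hidden in [Phi] is harmless: injectivity of [iB] and [jD] makes
   them agree with any given pair. *)
have PhiE d' e' p w : diff_tower iB jD d' e' p ->
    weil_der jD u d' e' p w <-> w = Phi p.
  move=> ht; have pD : DerB iB jD p by exists d', e'.
  have [d2 [e2 [ht2 hPhi]]] := PhiP p pD.
  have [d12 e12] := diff_tower_uniq iBI jDI ht ht2.
  rewrite -{}d12 -{}e12 {ht2} in hPhi; split=> [hw|->] //.
  case: ht => h1 h2 h3.
  have [w0 [_ w0U]] := weil_der_exists_unique h1 h2 hu h3.
  by rewrite -(w0U w) // -(w0U (Phi p)).
exists Phi; split.
- by move=> d' e' p ht w; apply: PhiE.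
- move=> p1 p2 /PhiP[d1 [e1 [t1 h1]]] /PhiP[d2 [e2 [t2 h2]]].
  (* By the characterization [PhiE], it suffices that [Phi p1 \+ Phi p2] has the defining property
     for the sum tower. Brackets and scalars go the same way. *)
  apply/esym/(PhiE _ _ _ _ (diff_towerD t1 t2)).
  by case: t1 t2 => [_ ? _] [_ ? _]; apply: weil_derD.
- move=> p1 p2 /PhiP[d1 [e1 [t1 h1]]] /PhiP[d2 [e2 [t2 h2]]].
  apply/esym/(PhiE _ _ _ _ (diff_tower_bracket t1 t2)).
  by case: t1 t2 => [_ ? _] [_ ? _]; apply: weil_der_bracket.
- move=> a p /PhiP[d1 [e1 [t1 h1]]].
  apply/esym/(PhiE _ _ _ _ (diff_towerZ a t1)).
  by case: t1 => [_ ? _]; apply: weil_derZ.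
Qed.
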